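(* Let $a<b$. Assume that $f,g:[a,b]\to\mathbb{R}$ are two absolutely $\beta$-integrable functions on $[a,b]$. If $a\le s_0\le b$, then $$T_\beta(f,g)^2\le T_\beta(f,f)\,T_\beta(g,g).$$
   Context: Setting: $I\subseteq\mathbb{R}$ is an interval, $a,b\in I$, and $\beta:I\to I$ is a strictly increasing continuous function with exactly one fixed point $s_0\in I$, satisfying $(t-s_0)(\beta(t)-t)\le 0$ for all $t\in I$, with equality only if $t=s_0$. Write $\beta^0(t)=t$ and $\beta^k$ for the $k$-fold composition of $\beta$ with itself. The $\beta$-integral is $\int_a^b h\,d_\beta:=\int_{s_0}^b h\,d_\beta-\int_{s_0}^a h\,d_\beta$, where $\int_{s_0}^x h\,d_\beta:=\sum_{k=0}^{\infty}\big(\beta^k(x)-\beta^{k+1}(x)\big)h\big(\beta^k(x)\big)$; also written $\int_a^b h(x)\,d_\beta x$. The function $h$ is $\beta$-integrable on $[a,b]$ if these series converge for $x=a$ and $x=b$, and absolutely $\beta$-integrable on $[a,b]$ if $|h|$ is $\beta$-integrable on $[a,b]$. For two absolutely $\beta$-integrable functions $f,g:[a,b]\to\mathbb{R}$ on $[a,b]$, the Chebyshev functional is $$T_\beta(f,g):=\frac{1}{b-a}\int_a^b f(x)g(x)\,d_\beta x-\left(\frac{1}{b-a}\int_a^b f(x)\,d_\beta x\right)\left(\frac{1}{b-a}\int_a^b g(x)\,d_\beta x\right).$$ *)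

(* Defs.v *)
From HB Require Import structures.
From mathcomp Require Import all_boot all_order all_algebra.
From mathcomp Require Import all_classical all_reals all_analysis.

Set Implicit Arguments.
Unset Strict Implicit.
Unset Printing Implicit Defensive.

Import Order.TTheory GRing.Theory Num.Theory.
Import numFieldNormedType.Exports.

Local Open Scope classical_set_scope.
Local Open Scope ring_scope.

(* A function I -> I is represented by a total function R -> R of which only
   the values on I are constrained. *)
Record is_beta_function (R : realType) (I : set R) (beta : R -> R) (s0 : R)
    : Prop := IsBetaFunction {
  beta_stable : forall t, I t -> I (beta t) ;
  beta_increasing : forall s t, I s -> I t -> s < t -> beta s < beta t ;
  beta_continuous : {within I, continuous beta} ;
  beta_fixpoint_in : I s0 ;
  beta_fixpoint : beta s0 = s0 ;
  beta_fixpoint_unique : forall t, I t -> beta t = t -> t = s0 ;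
  beta_sign : forall t, I t -> (t - s0) * (beta t - t) <= 0 ;
  beta_sign_eq : forall t, I t -> (t - s0) * (beta t - t) = 0 -> t = s0
}.

Section BetaIntegral.
Context {R : realType}.
Implicit Types (beta h f g : R -> R) (a b x : R).

Definition beta_term beta h x (k : nat) : R :=
  (iter k beta x - iter k.+1 beta x) * h (iter k beta x).

Definition beta_integrable beta a b h : Prop :=
  cvgn (series (beta_term beta h a)) /\ cvgn (series (beta_term beta h b)).

Definition abs_beta_integrable beta a b h : Prop :=
  beta_integrable beta a b (fun x => `|h x|).

(* The integral is valued in the extended reals, because absolute
   beta-integrability of f does not imply that of f ^ 2: when s0 lies in
   [a, b] and h >= 0, a divergent integral then has the value +oo.  On
   beta-integrable functions it is the usual real number, see
   [beta_integralE]. *)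
Definition beta_integral0 beta x h : \bar R :=
  (\sum_(0 <= k <oo) (beta_term beta h x k)%:E)%E.

Definition beta_integral beta a b h : \bar R :=
  (beta_integral0 beta b h - beta_integral0 beta a h)%E.

(* For s0 in [a, b] and f, g absolutely beta-integrable, the series of f * g can
   fail to converge only when f ^ 2 or g ^ 2 has an infinite integral; then
   T(f, f) * T(g, g) = +oo, so the unspecified value of T(f, g) is harmless in
   the Cauchy-Schwarz inequality. *)
Definition beta_chebyshev beta a b f g : \bar R :=
  ((1 / (b - a))%:E * beta_integral beta a b (fun x => (f x * g x)%R)
   - ((1 / (b - a))%:E * beta_integral beta a b f)
     * ((1 / (b - a))%:E * beta_integral beta a b g))%E.

Lemma beta_integral0E beta x h : cvgn (series (beta_term beta h x)) ->
  beta_integral0 beta x h = (limn (series (beta_term beta h x)))%:E.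
Proof.
move=> cv; rewrite /beta_integral0 -EFin_lim //; congr (limn _).
by apply/funext => n /=; rewrite sumEFin.
Qed.

Lemma beta_integralE beta a b h : beta_integrable beta a b h ->
  beta_integral beta a b h =
  (limn (series (beta_term beta h b)) - limn (series (beta_term beta h a)))%:E.
Proof. by move=> [cva cvb]; rewrite /beta_integral !beta_integral0E. Qed.

Lemma beta_chebyshevE beta a b f g :
    beta_integrable beta a b f -> beta_integrable beta a b g ->
    beta_integrable beta a b (fun x => f x * g x) ->
  let J h :=
    limn (series (beta_term beta h b)) - limn (series (beta_term beta h a)) in
  beta_chebyshev beta a b f g =
  (1 / (b - a) * J (fun x => f x * g x)
   - (1 / (b - a) * J f) * (1 / (b - a) * J g))%:E.
Proof. by move=> If Ig Ifg J; rewrite /beta_chebyshev !beta_integralE. Qed.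

End BetaIntegral.

(* Main.v *)
(* For a <= s0 <= b the beta-integral is integration against the discrete
   measure putting nonnegative weights on the orbits of a and b.  Its total mass
   telescopes to b - a, because both orbits converge to the fixed point s0.  With
   m the mean of h, T(h, h) is the normalised integral of (h - m) ^ 2, hence
   nonnegative; for h = x f + y g it is a quadratic form in (x, y), whose
   discriminant gives the inequality.  The case of a divergent integral of f ^ 2
   or g ^ 2 is separate. *)
Require Import Defs.
From HB Require Import structures.
From mathcomp Require Import all_boot all_order all_algebra.
From mathcomp Require Import all_classical all_reals all_analysis.
From mathcomp Require Import ring lra.

Import Order.TTheory GRing.Theory Num.Theory.
Import numFieldNormedType.Exports.

Local Open Scope classical_set_scope.
Local Open Scope ring_scope.

Set Implicit Arguments.
Unset Strict Implicit.

(** * Orbits of [beta]: signs of the weights and convergence to [s0] *)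

Definition beta_weight {R : realType} (beta : R -> R) (x : R) (k : nat) : R :=
  iter k beta x - iter k.+1 beta x.

Lemma beta_orbit_stable (R : realType) (I : set R) (beta : R -> R) (s0 x : R)
    (hbeta : is_beta_function I beta s0) (Ix : I x) (k : nat) :
  I (iter k beta x).
Proof. by elim: k => //= k; exact: (beta_stable hbeta). Qed.

Lemma beta_orbit_ge (R : realType) (I : set R) (beta : R -> R) (s0 x : R)
    (hbeta : is_beta_function I beta s0) (Ix : I x) (s0x : s0 <= x) (k : nat) :
  s0 <= iter k beta x.
Proof.
elim: k => //= k; rewrite le_eqVlt => /predU1P[<-|s0k].
  by rewrite (beta_fixpoint hbeta).
rewrite -(beta_fixpoint hbeta); apply/ltW/(beta_increasing hbeta) => //.
  exact: beta_fixpoint_in hbeta.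
exact: beta_orbit_stable hbeta Ix k.
Qed.

Lemma beta_orbit_le (R : realType) (I : set R) (beta : R -> R) (s0 x : R)
    (hbeta : is_beta_function I beta s0) (Ix : I x) (xs0 : x <= s0) (k : nat) :
  iter k beta x <= s0.
Proof.
elim: k => //= k; rewrite le_eqVlt => /predU1P[->|ks0].
  by rewrite (beta_fixpoint hbeta).
rewrite -[leRHS](beta_fixpoint hbeta).
apply/ltW/(beta_increasing hbeta) => //.
  exact: beta_orbit_stable hbeta Ix k.
exact: beta_fixpoint_in hbeta.
Qed.

(** At an orbit point [t > s0] the factor [t - s0] in [beta_sign] is positive, which forces
    [beta t <= t]; at [t = s0] the weight vanishes. *)
Lemma beta_weight_ge0 (R : realType) (I : set R) (beta : R -> R) (s0 x : R)
    (hbeta : is_beta_function I beta s0) (Ix : I x) (s0x : s0 <= x) (k : nat) :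
  0 <= beta_weight beta x k.
Proof.
have := beta_sign hbeta (beta_orbit_stable hbeta Ix k).
have := beta_orbit_ge hbeta Ix s0x k.
rewrite /beta_weight iterS le_eqVlt => /predU1P[<- _|s0k].
  by rewrite (beta_fixpoint hbeta) subrr.
by rewrite pmulr_rle0 ?subr_gt0// subr_le0 subr_ge0.
Qed.

Lemma beta_weight_le0 (R : realType) (I : set R) (beta : R -> R) (s0 x : R)
    (hbeta : is_beta_function I beta s0) (Ix : I x) (xs0 : x <= s0) (k : nat) :
  beta_weight beta x k <= 0.
Proof.
have := beta_sign hbeta (beta_orbit_stable hbeta Ix k).
have := beta_orbit_le hbeta Ix xs0 k.
rewrite /beta_weight iterS le_eqVlt => /predU1P[-> _|ks0].
  by rewrite (beta_fixpoint hbeta) subrr.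
by rewrite nmulr_rle0 ?subr_lt0// subr_ge0 subr_le0.
Qed.

Lemma beta_orbit_limit (R : realType) (I : set R) (beta : R -> R) (s0 x l : R)
    (hbeta : is_beta_function I beta s0) (Ix : I x) (Il : I l)
    (xl : iter k beta x @[k --> \oo] --> l) :
  l = s0.
Proof.
apply: (beta_fixpoint_unique hbeta Il).
have /subspace_continuousP/(_ l Il) cb := beta_continuous hbeta.
(* The orbit stays in [I], so it also converges for the filter within [I], the only one that
   continuity of [beta] on [I] controls. *)
have wl : iter k beta x @[k --> \oo] --> within I (nbhs l).
  move=> A /xl [N _ NA]; exists N => // k /NA; apply.
  exact: beta_orbit_stable hbeta Ix k.
have := cvg_comp _ _ wl cb; rewrite -(cvg_shiftS (fun k => iter k beta x)) in xl.
by move=> /cvg_unique; apply.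
Qed.

(** The orbit is monotone and bounded by [s0], so it converges between [x] and [s0]. This places the
    limit in the interval [I], where [beta_orbit_limit] applies. *)
Lemma cvg_beta_orbit (R : realType) (I : set R) (beta : R -> R) (s0 x : R)
    (Iint : is_interval I) (hbeta : is_beta_function I beta s0) (Ix : I x) :
  iter k beta x @[k --> \oo] --> s0.
Proof.
have Is0 := beta_fixpoint_in hbeta.
suff [l Il xl] : exists2 l, I l & iter k beta x @[k --> \oo] --> l.
  by rewrite -(beta_orbit_limit hbeta Ix Il xl).
have [s0x|/ltW xs0] := leP s0 x.
- have lb := beta_orbit_ge hbeta Ix s0x.
  have dec : {homo (fun k => iter k beta x) : n m / (n <= m)%N >-> m <= n}.
    apply/nonincreasing_seqP => k; rewrite -subr_ge0.
    exact: beta_weight_ge0 hbeta Ix s0x k.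
  have cv : cvgn (fun k => iter k beta x).
    by apply: nonincreasing_is_cvgn => //; exists s0 => _ [k _ <-].
  exists (limn (fun k => iter k beta x)) => //.
  apply: (Iint s0 x) => //; apply/andP; split.
    by apply: limr_ge => //; exact: nearW.
  exact: nonincreasing_cvgn_ge cv 0%N.
- have ub := beta_orbit_le hbeta Ix xs0.
  have inc : {homo (fun k => iter k beta x) : n m / (n <= m)%N >-> n <= m}.
    apply/nondecreasing_seqP => k; rewrite -subr_le0.
    exact: beta_weight_le0 hbeta Ix xs0 k.
  have cv : cvgn (fun k => iter k beta x).
    by apply: nondecreasing_is_cvgn => //; exists s0 => _ [k _ <-].
  exists (limn (fun k => iter k beta x)) => //.
  apply: (Iint x s0) => //; apply/andP; split.
    exact: nondecreasing_cvgn_le cv 0%N.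
  by apply: limr_le => //; exact: nearW.
Qed.

Lemma cvg_series_beta_weight (R : realType) (I : set R) (beta : R -> R)
    (s0 x : R) (Iint : is_interval I) (hbeta : is_beta_function I beta s0)
    (Ix : I x) :
  series (beta_weight beta x) @ \oo --> x - s0.
Proof.
have -> : series (beta_weight beta x) = (fun k => x - iter k beta x).
  apply/funext => n; rewrite /series /=.
  under eq_bigr do rewrite /beta_weight -opprB.
  by rewrite sumrN telescope_sumr// opprB.
apply: cvgB; first exact: cvg_cst.
exact: cvg_beta_orbit Iint hbeta Ix.
Qed.

(** * Linearity, positivity and variance of the integral *)

(* [has_beta_integral beta a b h l] is weaker than convergence at [a] and [b]
   separately, but it suffices for linearity and positivity. *)
Definition has_beta_integral {R : realType} (beta : R -> R) (a b : R)
    (h : R -> R) (l : R) : Prop :=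
  series (fun k => beta_term beta h b k - beta_term beta h a k) @ \oo --> l.

Lemma beta_integrable_has (R : realType) (beta : R -> R) (a b : R)
    (h : R -> R) (hi : beta_integrable beta a b h) :
  exists2 l, has_beta_integral beta a b h l & beta_integral beta a b h = l%:E.
Proof.
case: (hi) => ca cb; eexists; last exact: beta_integralE.
rewrite /has_beta_integral.
have -> : series (fun k => beta_term beta h b k - beta_term beta h a k) =
    series (beta_term beta h b) - series (beta_term beta h a).
  by rewrite -seriesN -seriesD.
exact: cvgB.
Qed.

Lemma has_beta_integral_linear (R : realType) (beta : R -> R) (a b c d : R)
    (f g : R -> R) (l m : R) (hf : has_beta_integral beta a b f l)
    (hg : has_beta_integral beta a b g m) :
  has_beta_integral beta a b (fun x => c * f x + d * g x) (c * l + d * m).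
Proof.
rewrite /has_beta_integral in hf hg *.
set F := series (fun k => beta_term beta f b k - _) in hf.
set G := series (fun k => beta_term beta g b k - _) in hg.
rewrite (_ : series _ = (fun n => c * F n + d * G n)); last first.
  apply/funext => n; rewrite /F /G /series /= !mulr_sumr -big_split /=.
  by apply: eq_bigr => k _; rewrite /beta_term; ring.
apply: cvgD; exact: cvgMr.
Qed.

Arguments has_beta_integral_linear {R beta a b} c d {f g l m} hf hg.

Lemma has_beta_integral_unique (R : realType) (beta : R -> R) (a b : R)
    (h : R -> R) (l m : R) (hl : has_beta_integral beta a b h l)
    (hm : has_beta_integral beta a b h m) : l = m.
Proof. exact: cvg_unique hl hm. Qed.

Lemma has_beta_integral1 (R : realType) (I : set R) (beta : R -> R)
    (s0 a b : R) (Iint : is_interval I) (hbeta : is_beta_function I beta s0)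
    (Ia : I a) (Ib : I b) :
  has_beta_integral beta a b (fun=> 1) (b - a).
Proof.
rewrite /has_beta_integral.
rewrite (_ : series _ =
    series (beta_weight beta b) - series (beta_weight beta a)); last first.
  rewrite -seriesN -seriesD; congr series; apply/funext => k.
  by rewrite /beta_term !mulr1.
have -> : b - a = (b - s0) - (a - s0) by ring.
apply: cvgB; exact: cvg_series_beta_weight hbeta _.
Qed.

(** All summands are nonnegative, so each is at most a partial sum, and each partial sum is at most
    the limit. Both positivity and the vanishing criterion follow from this bound. *)
Lemma has_beta_integral_terms (R : realType) (beta : R -> R) (a b : R)
    (h : R -> R) (l : R) (wa : forall k, beta_weight beta a k <= 0)
    (wb : forall k, 0 <= beta_weight beta b k) (h0 : forall x, 0 <= h x)
    (hl : has_beta_integral beta a b h l) (k : nat) :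
  beta_term beta h b k - beta_term beta h a k <= l.
Proof.
have t0 j : 0 <= beta_term beta h b j - beta_term beta h a j.
  by rewrite subr_ge0; apply: (@le_trans _ _ 0);
    [apply: mulr_le0_ge0 | apply: mulr_ge0] => //; [exact: wa|exact: wb].
have := nondecreasing_cvgn_le
  (@nondecreasing_series _ _ xpredT 0 (fun n _ _ => t0 n)) (cvgP _ hl) k.+1.
rewrite (cvg_lim _ hl)//; apply: le_trans.
rewrite /series /= big_nat_recr//= lerDr.
by apply: sumr_ge0.
Qed.

Lemma has_beta_integral_ge0 (R : realType) (beta : R -> R) (a b : R)
    (h : R -> R) (l : R) (wa : forall k, beta_weight beta a k <= 0)
    (wb : forall k, 0 <= beta_weight beta b k) (h0 : forall x, 0 <= h x)
    (hl : has_beta_integral beta a b h l) :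
  0 <= l.
Proof.
apply: le_trans (has_beta_integral_terms wa wb h0 hl 0%N).
rewrite subr_ge0; apply: (@le_trans _ _ 0).
  by apply: mulr_le0_ge0 => //; exact: wa.
by apply: mulr_ge0 => //; exact: wb.
Qed.

Lemma has_beta_integral_eq0 (R : realType) (beta : R -> R) (a b : R)
    (h : R -> R) (wa : forall k, beta_weight beta a k <= 0)
    (wb : forall k, 0 <= beta_weight beta b k) (h0 : forall x, 0 <= h x)
    (hl : has_beta_integral beta a b h 0) (k : nat) :
  beta_term beta h a k = 0 /\ beta_term beta h b k = 0.
Proof.
have := has_beta_integral_terms wa wb h0 hl k.
have : beta_term beta h a k <= 0 by apply: mulr_le0_ge0 => //; exact: wa.
have : 0 <= beta_term beta h b k by apply: mulr_ge0 => //; exact: wb.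
by split; lra.
Qed.

(** Expand the square around the mean [c]: as the total mass is [b - a], the terms [- 2 * c * H] and
    [c ^+ 2 * (b - a)] add up to [- (b - a)^-1 * H ^+ 2]. *)
Lemma has_beta_integral_variance (R : realType) (beta : R -> R) (a b : R)
    (h : R -> R) (H B : R) (ab : a < b)
    (h1 : has_beta_integral beta a b (fun=> 1) (b - a))
    (hH : has_beta_integral beta a b h H)
    (hB : has_beta_integral beta a b (fun x => h x * h x) B) :
  has_beta_integral beta a b (fun x => (h x - (b - a)^-1 * H) ^+ 2)
    (B - (b - a)^-1 * H ^+ 2).
Proof.
have ba0 : b - a != 0 by rewrite subr_eq0 gt_eqF.
set c := (b - a)^-1 * H.
have := has_beta_integral_linear 1 1 hB
  (has_beta_integral_linear (- (2 * c)) (c ^+ 2) hH h1).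
rewrite (_ : (fun x => 1 * _ + _) = (fun x => (h x - c) ^+ 2)); last first.
  by apply/funext => x; ring.
rewrite (_ : 1 * B + _ = B - (b - a)^-1 * H ^+ 2)//.
by rewrite /c; field.
Qed.

(** * Discriminants, domination and divergence *)

Lemma quadratic_form_discr (R : realFieldType) (p q r : R)
    (hq : forall x y, 0 <= x ^+ 2 * p + 2 * x * y * q + y ^+ 2 * r) :
  q ^+ 2 <= p * r.
Proof.
have r0 : 0 <= r by have := hq 0 1; lra.
have [r_gt0|] := ltP 0 r.
  rewrite -subr_ge0 -(pmulr_rge0 _ r_gt0).
  (* At [(r, - q)] the form equals [r * (p * r - q ^+ 2)]. *)
  by have := hq r (- q); lra.
move=> r_le0; have rE : r = 0 by lra.
(* With [r = 0] this point is chosen so that the form equals [- q ^+ 2]. *)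
by have := hq q (- (p + 1) / 2); rewrite rE; nra.
Qed.

(** Weights of constant sign make the majorant, the absolute weight times [h2], equal to the terms
    of [h2] up to a global sign. *)
Lemma beta_term_dominated_cvg (R : realType) (beta : R -> R) (x : R)
    (h1 h2 : R -> R) (le12 : forall t, `|h1 t| <= h2 t)
    (wx : (forall k, 0 <= beta_weight beta x k) \/
          (forall k, beta_weight beta x k <= 0))
    (c2 : cvgn (series (beta_term beta h2 x))) :
  cvgn (series (beta_term beta h1 x)).
Proof.
apply: normed_cvg.
apply: (@series_le_cvg _ _
  (fun k => `|beta_weight beta x k| * h2 (iter k beta x))).
- by move=> k; exact: normr_ge0.
- by move=> k; rewrite mulr_ge0// (le_trans _ (le12 _)).
- by move=> k; rewrite /= /beta_term normrM ler_wpM2l.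
case: wx => wx.
  rewrite (_ : (fun k => _) = beta_term beta h2 x)//.
  by apply/funext => k; rewrite ger0_norm.
rewrite (_ : (fun k => _) = - beta_term beta h2 x) ?is_cvg_seriesN//.
by apply/funext => k; rewrite ler0_norm// mulNr.
Qed.

Lemma beta_integrable_dominated (R : realType) (beta : R -> R) (a b : R)
    (h1 h2 : R -> R) (wa : forall k, beta_weight beta a k <= 0)
    (wb : forall k, 0 <= beta_weight beta b k)
    (le12 : forall t, `|h1 t| <= h2 t) (hi : beta_integrable beta a b h2) :
  beta_integrable beta a b h1.
Proof.
by case: hi => ca cb; split; apply: (@beta_term_dominated_cvg _ _ _ _ h2) => //;
  [right|left].
Qed.

Lemma beta_integrableD (R : realType) (beta : R -> R) (a b : R)
    (f g : R -> R) (hf : beta_integrable beta a b f)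
    (hg : beta_integrable beta a b g) :
  beta_integrable beta a b (fun x => f x + g x).
Proof.
case: hf hg => [fa fb] [ga gb].
have E x : beta_term beta (fun x => f x + g x) x =
    beta_term beta f x + beta_term beta g x.
  by apply/funext => k; rewrite /beta_term mulrDr.
by split; rewrite E seriesD; apply: is_cvgD.
Qed.

(** A divergent series at [b] increases to [+oo] and one at [a] decreases to [-oo], so the
    difference never has the form [+oo - +oo]. *)
Lemma beta_integral_dvg (R : realType) (beta : R -> R) (a b : R)
    (h : R -> R) (wa : forall k, beta_weight beta a k <= 0)
    (wb : forall k, 0 <= beta_weight beta b k) (h0 : forall x, 0 <= h x)
    (hi : ~ beta_integrable beta a b h) :
  beta_integral beta a b h = +oo%E.
Proof.
have Eb : ~ cvgn (series (beta_term beta h b)) ->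
    beta_integral0 beta b h = +oo%E.
  move=> nc; apply/cvg_lim => //.
  rewrite (_ : (fun n => _) = (fun n => (series (beta_term beta h b) n)%:E)).
    apply/cvgeryP/nondecreasing_dvgn_lt => //; apply: nondecreasing_series.
    by move=> n _ _; apply: mulr_ge0 => //; exact: wb.
  by apply/funext => n; rewrite /series /= sumEFin.
have Ea : ~ cvgn (series (beta_term beta h a)) ->
    beta_integral0 beta a h = -oo%E.
  move=> nc; apply/cvg_lim => //.
  rewrite (_ : (fun n => _) = (fun n => (series (beta_term beta h a) n)%:E)).
    apply/cvgerNyP/cvgNry; rewrite -is_cvg_seriesN -seriesN in nc *.
    apply: nondecreasing_dvgn_lt => //; apply: nondecreasing_series => n _ _.
    by rewrite oppr_ge0; apply: mulr_le0_ge0 => //; exact: wa.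
  by apply/funext => n; rewrite /series /= sumEFin.
rewrite /beta_integral.
have [ca|/Ea ->] := pselect (cvgn (series (beta_term beta h a)));
have [cb|/Eb ->] := pselect (cvgn (series (beta_term beta h b))) => //.
- by case: hi.
- by rewrite (beta_integral0E ca).
- by rewrite (beta_integral0E cb).
Qed.

(** * The Chebyshev functional and its Cauchy-Schwarz inequality *)

Lemma beta_chebyshevC (R : realType) (beta : R -> R) (a b : R)
    (f g : R -> R) : beta_chebyshev beta a b f g = beta_chebyshev beta a b g f.
Proof.
rewrite /beta_chebyshev [X in (_ - X)%E]muleC.
rewrite (_ : (fun x => f x * g x) = (fun x => g x * f x))//.
by apply/funext => x; rewrite mulrC.
Qed.

Lemma beta_chebyshev_fin (R : realType) (beta : R -> R) (a b : R)
    (f g : R -> R) (F G C : R) (hF : beta_integral beta a b f = F%:E)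
    (hG : beta_integral beta a b g = G%:E)
    (hC : beta_integral beta a b (fun x => f x * g x) = C%:E) :
  beta_chebyshev beta a b f g =
  ((b - a)^-1 * C - (b - a)^-1 ^+ 2 * (F * G))%:E.
Proof.
rewrite /beta_chebyshev hF hG hC -!EFinM -EFinB; congr _%:E.
by rewrite !div1r; ring.
Qed.

(** Only the integral of the square is infinite; the subtracted product of means is finite because
    [f] is integrable. *)
Lemma beta_chebyshev_pinfty (R : realType) (beta : R -> R) (a b : R)
    (f : R -> R) (ab : a < b)
    (wa : forall k, beta_weight beta a k <= 0)
    (wb : forall k, 0 <= beta_weight beta b k)
    (hf : beta_integrable beta a b f)
    (nff : ~ beta_integrable beta a b (fun x => f x * f x)) :
  beta_chebyshev beta a b f f = +oo%E.
Proof.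
have [F _ FE] := beta_integrable_has hf.
rewrite /beta_chebyshev FE beta_integral_dvg//; last first.
  by move=> x; rewrite -expr2 sqr_ge0.
by rewrite gt0_muley// lte_fin divr_gt0// subr_gt0.
Qed.

Lemma beta_chebyshev_ge0 (R : realType) (beta : R -> R) (a b : R)
    (f : R -> R) (ab : a < b)
    (wa : forall k, beta_weight beta a k <= 0)
    (wb : forall k, 0 <= beta_weight beta b k)
    (h1 : has_beta_integral beta a b (fun=> 1) (b - a))
    (hf : beta_integrable beta a b f) :
  (0 <= beta_chebyshev beta a b f f)%E.
Proof.
have [hff|nff] := pselect (beta_integrable beta a b (fun x => f x * f x));
  last by rewrite beta_chebyshev_pinfty.
have [F hF FE] := beta_integrable_has hf.
have [B hB BE] := beta_integrable_has hff.
rewrite (beta_chebyshev_fin FE FE BE) lee_fin.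
have := has_beta_integral_ge0 wa wb (fun=> sqr_ge0 _)
  (has_beta_integral_variance ab h1 hF hB).
rewrite -(@pmulr_rge0 _ (b - a)^-1) ?invr_gt0 ?subr_gt0//.
by congr (_ <= _); ring.
Qed.

(* When the integral of [f ^ 2] diverges, [T(f, f) = +oo], and the product with
   [T(g, g)] is [+oo] unless [T(g, g) = 0]; then [g] is constant on the orbits of
   [a] and [b] wherever the weights do not vanish, so that [T(f, g) = 0]. *)
Lemma beta_chebyshev_dvg (R : realType) (beta : R -> R) (a b : R)
    (f g : R -> R) (ab : a < b)
    (wa : forall k, beta_weight beta a k <= 0)
    (wb : forall k, 0 <= beta_weight beta b k)
    (h1 : has_beta_integral beta a b (fun=> 1) (b - a))
    (hf : beta_integrable beta a b f) (hg : beta_integrable beta a b g)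
    (nff : ~ beta_integrable beta a b (fun x => f x * f x)) :
  (beta_chebyshev beta a b f g ^+ 2
   <= beta_chebyshev beta a b f f * beta_chebyshev beta a b g g)%E.
Proof.
rewrite (beta_chebyshev_pinfty ab wa wb hf nff).
have := beta_chebyshev_ge0 ab wa wb h1 hg.
rewrite le_eqVlt => /predU1P[Tg0|Tg]; last by rewrite gt0_mulye// leey.
have hgg : beta_integrable beta a b (fun x => g x * g x).
  by apply: contrapT => ngg; rewrite beta_chebyshev_pinfty in Tg0.
have [F hF FE] := beta_integrable_has hf.
have [G hG GE] := beta_integrable_has hg.
have [B hB BE] := beta_integrable_has hgg.
have ba0 : (b - a)^-1 != 0 by rewrite invr_neq0// subr_eq0 gt_eqF.
(* [T(g, g)] is [(b - a)^-1] times the integral of the squared deviation of [g] from its mean. *)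
have V0 : B - (b - a)^-1 * G ^+ 2 = 0.
  move: Tg0; rewrite (beta_chebyshev_fin GE GE BE) => -[] /esym/eqP.
  rewrite (_ : _ - _ = (b - a)^-1 * (B - (b - a)^-1 * G ^+ 2)); last by ring.
  by rewrite mulf_eq0 (negPf ba0) => /eqP.
have := has_beta_integral_variance ab h1 hG hB.
rewrite V0; set c := (b - a)^-1 * G => hV.
have gc := has_beta_integral_eq0 wa wb (fun=> sqr_ge0 _) hV.
(* At each index either the weight is zero or [g] takes its mean value [c]; in both cases the term
   of [f * g] is [c] times that of [f]. *)
have fgc x : (forall k, beta_term beta (fun t => (g t - c) ^+ 2) x k = 0) ->
    beta_term beta (fun t => f t * g t) x = c *: beta_term beta f x.
  move=> gx; apply/funext => k; have /eqP := gx k.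
  change ((c *: beta_term beta f x) k) with (c * beta_term beta f x k).
  rewrite /beta_term mulf_eq0 sqrf_eq0.
  move=> /orP[/eqP -> | /eqP/subr0_eq ->]; first by rewrite !mul0r mulr0.
  by ring.
have [fga fgb] := (fgc a (fun k => (gc k).1), fgc b (fun k => (gc k).2)).
have hfg : beta_integrable beta a b (fun t => f t * g t).
  by case: hf => fa fb; split; rewrite ?fga ?fgb seriesZ; exact: is_cvgZr.
have CE : beta_integral beta a b (fun t => f t * g t) = (c * F)%:E.
  have [C hC ->] := beta_integrable_has hfg; congr _%:E.
  apply: has_beta_integral_unique hC _.
  have := has_beta_integral_linear c 0 hF hF; rewrite mul0r addr0.
  rewrite /has_beta_integral fga fgb; congr (cvg_to (series _ @ \oo) _).
  apply/funext => k.
  change ((c *: beta_term beta f b) k) with (c * beta_term beta f b k).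
  change ((c *: beta_term beta f a) k) with (c * beta_term beta f a k).
  by rewrite /beta_term; ring.
(* Since [+oo * 0 = 0], the right side is zero, and [T(f, g)] has to vanish exactly; it does because
   [c = (b - a)^-1 * G]. *)
rewrite (beta_chebyshev_fin FE GE CE) -Tg0 mule0 /c.
by rewrite (_ : _ - _ = 0) ?expe2 ?mule0//; ring.
Qed.

Lemma beta_chebyshev_cauchy_schwarz (R : realType) (beta : R -> R) (a b : R)
    (f g : R -> R) (ab : a < b)
    (wa : forall k, beta_weight beta a k <= 0)
    (wb : forall k, 0 <= beta_weight beta b k)
    (h1 : has_beta_integral beta a b (fun=> 1) (b - a))
    (hf : beta_integrable beta a b f) (hg : beta_integrable beta a b g)
    (hff : beta_integrable beta a b (fun x => f x * f x))
    (hgg : beta_integrable beta a b (fun x => g x * g x)) :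
  (beta_chebyshev beta a b f g ^+ 2
   <= beta_chebyshev beta a b f f * beta_chebyshev beta a b g g)%E.
Proof.
have hfg : beta_integrable beta a b (fun x => f x * g x).
  apply: (beta_integrable_dominated wa wb _ (beta_integrableD hff hgg)) => t.
  (* The bound [|f g| <= f ^ 2 + g ^ 2] makes the product integrable. *)
  by rewrite ler_norml; apply/andP; split; nra.
have [F hF FE] := beta_integrable_has hf.
have [G hG GE] := beta_integrable_has hg.
have [A hA AE] := beta_integrable_has hff.
have [B hB BE] := beta_integrable_has hgg.
have [C hC CE] := beta_integrable_has hfg.
rewrite (beta_chebyshev_fin FE GE CE) (beta_chebyshev_fin FE FE AE).
rewrite (beta_chebyshev_fin GE GE BE) -EFin_expe -EFinM lee_fin.
(* The form at [(x, y)] is [T(h, h)] for [h = x f + y g], with [hH] and [hH2] giving the integrals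
   of [h] and of its square. *)
apply: quadratic_form_discr => x y.
have hH := has_beta_integral_linear x y hF hG.
have hH2 := has_beta_integral_linear 1 (y ^+ 2)
  (has_beta_integral_linear (x ^+ 2) (2 * x * y) hA hC) hB.
rewrite (_ : (fun t => 1 * _ + _) =
    (fun t => (x * f t + y * g t) * (x * f t + y * g t))) in hH2; last first.
  by apply/funext => t; ring.
have := has_beta_integral_ge0 wa wb (fun=> sqr_ge0 _)
  (has_beta_integral_variance ab h1 hH hH2).
rewrite -(@pmulr_rge0 _ (b - a)^-1) ?invr_gt0 ?subr_gt0//.
by congr (_ <= _); ring.
Qed.

Unset Implicit Arguments.
Set Strict Implicit.

Theorem proposition3p6 (R : realType) (I : set R) (beta : R -> R) (s0 : R)
    (a b : R) (f g : R -> R)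
    (Iint : is_interval I)
    (hbeta : is_beta_function I beta s0)
    (Ia : I a) (Ib : I b) (ab : a < b)
    (hf : abs_beta_integrable beta a b f)
    (hg : abs_beta_integrable beta a b g)
    (as0 : a <= s0) (s0b : s0 <= b) :
  (beta_chebyshev beta a b f g ^+ 2
   <= beta_chebyshev beta a b f f * beta_chebyshev beta a b g g)%E.
Proof.
have wa := beta_weight_le0 hbeta Ia as0.
have wb := beta_weight_ge0 hbeta Ib s0b.
have h1 := has_beta_integral1 Iint hbeta Ia Ib.
(* Absolute integrability gives integrability, with [|f|] as its own majorant. *)
have {}hf := beta_integrable_dominated wa wb (fun t => lexx `|f t|) hf.
have {}hg := beta_integrable_dominated wa wb (fun t => lexx `|g t|) hg.
have [hff|nff] := pselect (beta_integrable beta a b (fun x => f x * f x));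
  last exact: beta_chebyshev_dvg.
have [hgg|ngg] := pselect (beta_integrable beta a b (fun x => g x * g x)).
  exact: beta_chebyshev_cauchy_schwarz.
(* Only [g ^ 2] diverges here, so the roles of [f] and [g] are exchanged. *)
by rewrite beta_chebyshevC [leRHS]muleC; exact: beta_chebyshev_dvg.
Qed.
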